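(* Let $T_n(t)=\sum_{\pi\in F_n(321,3124)}t^{\operatorname{lrmax}(\pi)}$ and $T(t,x)=\sum_{n=0}^\infty T_n(t)x^n$. Then $$T(t,x)=\frac{1-(t+1)x+tx^2+tx^3}{(1-tx-tx^2)(1-tx)(1-x)}.$$
   Context: A Fishburn permutation is a permutation $\pi$ (in one-line notation) with no subsequence $\pi_j,\pi_{j+1},\pi_k$ such that $j+1<k$, $\pi_j=\pi_k+1$, and $\pi_{j+1}>\pi_j$. $F_n(321,3124)$ is the set of Fishburn permutations of length $n$ avoiding the classical patterns $321$ and $3124$ (i.e. having no subsequence with the same relative order as either); for $n=0$ it consists of the empty permutation. $\operatorname{lrmax}(\pi)$ is the number of left-to-right maxima of $\pi$, i.e. entries greater than all entries to their left. The identity is one of formal power series. *)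

(* Defs.v *)
From HB Require Import structures.
From mathcomp Require Import all_boot all_order all_algebra all_fingroup.
From mathcomp Require Import boolp.

Set Implicit Arguments.
Unset Strict Implicit.
Unset Printing Implicit Defensive.

Import GRing.Theory.
Local Open Scope ring_scope.

(* Formal power series in one variable over R, with the Cauchy product.       *)
(* A record rather than a bare function type, so as not to meet the pointwise *)
(* ring structure on functions.                                               *)
Record fps (R : Type) := Fps { coefs : nat -> R }.

HB.instance Definition _ (R : Type) := gen_eqMixin (fps R).
HB.instance Definition _ (R : Type) := gen_choiceMixin (fps R).

Lemma fpsP (R : Type) (a b : fps R) :
  (forall n, coefs a n = coefs b n) -> a = b.
Proof. by case: a b => [a] [b] /= eq_ab; congr Fps; apply: funext. Qed.

Section Zmodule.
Variable R : zmodType.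
Implicit Types a b c : fps R.

Definition fps_zero : fps R := Fps (fun=> 0).
Definition fps_opp a : fps R := Fps (fun n => - coefs a n).
Definition fps_add a b : fps R := Fps (fun n => coefs a n + coefs b n).

Lemma fps_addA : associative fps_add.
Proof. by move=> a b c; apply: fpsP => n /=; rewrite addrA. Qed.

Lemma fps_addC : commutative fps_add.
Proof. by move=> a b; apply: fpsP => n /=; rewrite addrC. Qed.

Lemma fps_add0 : left_id fps_zero fps_add.
Proof. by move=> a; apply: fpsP => n /=; rewrite add0r. Qed.

Lemma fps_addN : left_inverse fps_zero fps_opp fps_add.
Proof. by move=> a; apply: fpsP => n /=; rewrite addNr. Qed.

HB.instance Definition _ :=
  GRing.isZmodule.Build (fps R) fps_addA fps_addC fps_add0 fps_addN.
End Zmodule.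

Section Ring.
Variable R : comNzRingType.
Implicit Types a b c : fps R.

Definition fps_const (r : R) : fps R := Fps (fun n => if n == 0%N then r else 0).
Definition fps_var : fps R := Fps (fun n => (n == 1%N)%:R).
Definition fps_mul a b : fps R :=
  Fps (fun n => \sum_(i < n.+1) coefs a i * coefs b (n - i)%N).

Definition fps_trunc (m : nat) a : {poly R} := \poly_(i < m) coefs a i.

Lemma coef_fps_mul a b m n : (n < m)%N ->
  coefs (fps_mul a b) n = (fps_trunc m a * fps_trunc m b)`_n.
Proof.
move=> lt_nm; rewrite coefM; apply: eq_bigr => i _.
by rewrite !coef_poly !(leq_ltn_trans _ lt_nm) ?leq_subr // -ltnS.
Qed.

Lemma fps_mulA : associative fps_mul.
Proof.
move=> a b c; apply: fpsP => n.
have truncM (p q : fps R) (i : nat) : (i <= n)%N ->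
    (fps_trunc n.+1 (fps_mul p q))`_i
      = (fps_trunc n.+1 p * fps_trunc n.+1 q)`_i.
  by move=> le_in; rewrite coef_poly ltnS le_in (@coef_fps_mul _ _ n.+1).
rewrite !(@coef_fps_mul _ _ n.+1) //.
transitivity
  (fps_trunc n.+1 a * (fps_trunc n.+1 b * fps_trunc n.+1 c))`_n.
  by rewrite !coefM; apply: eq_bigr => i _; rewrite truncM // leq_subr.
rewrite mulrA !coefM; apply: eq_bigr => i _.
by rewrite truncM // -ltnS.
Qed.

Lemma fps_mulC : commutative fps_mul.
Proof.
by move=> a b; apply: fpsP => n; rewrite !(@coef_fps_mul _ _ n.+1) // mulrC.
Qed.

Lemma fps_mul1 : left_id (fps_const 1) fps_mul.
Proof.
move=> a; apply: fpsP => n /=.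
rewrite big_ord_recl big1 /= => [|i _]; last by rewrite mul0r.
by rewrite mul1r addr0 subn0.
Qed.

Lemma fps_mulDl : left_distributive fps_mul +%R.
Proof.
move=> a b c; apply: fpsP => n /=; rewrite -big_split /=.
by apply: eq_bigr => i _; rewrite mulrDl.
Qed.

Lemma fps_one_neq0 : fps_const 1 != 0.
Proof.
by apply/eqP => /(congr1 (fun a => coefs a 0%N)) /eqP /=; rewrite oner_eq0.
Qed.

HB.instance Definition _ := GRing.Zmodule_isComNzRing.Build (fps R)
  fps_mulA fps_mulC fps_mul1 fps_mulDl fps_one_neq0.

Lemma coefs_mul a b n :
  coefs (a * b) n = \sum_(i < n.+1) coefs a i * coefs b (n - i)%N.
Proof. by []. Qed.

Lemma coefs_mul0 a b : coefs (a * b) 0 = coefs a 0 * coefs b 0.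
Proof. by rewrite coefs_mul big_ord1. Qed.

Lemma coefs_sum (I : Type) (r : seq I) (P : pred I) (F : I -> fps R) n :
  coefs (\sum_(i <- r | P i) F i) n = \sum_(i <- r | P i) coefs (F i) n.
Proof. by elim/big_rec2: _ => //= i y1 y2 _ <-. Qed.

Lemma coefs_exp_lt a k n : coefs a 0 = 0 -> (n < k)%N -> coefs (a ^+ k) n = 0.
Proof.
move=> a0; elim: k n => // k IHk n lt_nk.
rewrite exprS coefs_mul big1 // => -[[|i] lt_in] _ /=; first by rewrite a0 mul0r.
by rewrite IHk ?mulr0 // ltn_subLR // addSn ltnS (leq_trans _ (leq_addl _ _)).
Qed.
End Ring.

Section UnitRing.
Variable R : comUnitRingType.
Implicit Types a b : fps R.

Definition fps_unit : pred (fps R) := fun a => coefs a 0 \is a GRing.unit.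

(* With c the inverse of the constant term of a, the inverse of a is the      *)
(* geometric series c * \sum_k (1 - c * a)^k.                                 *)
Definition fps_inv a : fps R :=
  if fps_unit a then
    let c := fps_const (coefs a 0)^-1 in
    c * Fps (fun n => \sum_(k < n.+1) coefs ((1 - c * a) ^+ k) n)
  else a.

Lemma fps_mulV : {in fps_unit, left_inverse 1 fps_inv *%R}.
Proof.
move=> a ua; rewrite /fps_inv (ua : fps_unit a = true) /=.
set c := fps_const _; set g := Fps _; set u := 1 - c * a.
have u0 : coefs u 0 = 0 by rewrite /= big_ord1 /= mulVr // subrr.
rewrite mulrAC (_ : c * a = 1 - u); last by rewrite /u opprB addrC subrK.
apply: fpsP => n.
have gE i : (i <= n)%N -> coefs g i = coefs (\sum_(k < n.+1) u ^+ k) i.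
  move=> le_in; rewrite coefs_sum /g /=.
  rewrite -!(big_mkord xpredT (fun k => coefs (u ^+ k) i)).
  rewrite (@big_cat_nat _ _ _ i.+1 0 n.+1) //= [X in _ + X]big_nat.
  by rewrite [X in _ + X]big1 ?addr0 // => k /andP[lt_ik _]; apply: coefs_exp_lt.
transitivity (coefs ((1 - u) * \sum_(k < n.+1) u ^+ k) n).
  by rewrite !coefs_mul; apply: eq_bigr => i _; rewrite gE ?leq_subr.
by rewrite -opprB mulNr -subrX1 opprB /= coefs_exp_lt // oppr0 addr0.
Qed.

Lemma fps_unitPl a b : b * a = 1 -> fps_unit a.
Proof.
move=> /(congr1 (fun s => coefs s 0)); rewrite coefs_mul0 /= => ba1.
by apply/unitrPr; exists (coefs b 0); rewrite mulrC.
Qed.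

Lemma fps_inv_out : {in [predC fps_unit], fps_inv =1 id}.
Proof. by move=> a na; rewrite /fps_inv ifN. Qed.

HB.instance Definition _ := GRing.ComNzRing_hasMulInverse.Build (fps R)
  fps_mulV fps_unitPl fps_inv_out.
End UnitRing.

Section Permutations.
Local Open Scope nat_scope.

(* Permutations of length n are elements of 'S_n: positions and entries both  *)
(* range over 0, ..., n - 1.                                                  *)

Definition fishburn (n : nat) (s : 'S_n) : bool :=
  ~~ [exists j : 'I_n, exists j' : 'I_n, exists k : 'I_n,
       [&& j' == j.+1 :> nat, j.+1 < k, s j == (s k).+1 :> nat & s j' > s j]].

(* The pattern p is given in one-line notation. *)
Definition contains (p : seq nat) (n : nat) (s : 'S_n) : bool :=
  [exists f : {ffun 'I_(size p) -> 'I_n},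
    [forall a : 'I_(size p), forall b : 'I_(size p),
      ((a < b) ==> (f a < f b))
      && ((s (f a) < s (f b)) == (nth 0 p a < nth 0 p b))]].

Definition fishburn_321_3124 (n : nat) : {set 'S_n} :=
  [set s : 'S_n | [&& fishburn s, ~~ contains [:: 3; 2; 1] s
                   & ~~ contains [:: 3; 1; 2; 4] s]].

Definition lrmax (n : nat) (s : 'S_n) : nat :=
  #|[set i : 'I_n | [forall j : 'I_n, (j < i) ==> (s j < s i)]]|.
End Permutations.

Definition lrmax_poly (n : nat) : {poly int} :=
  \sum_(s in fishburn_321_3124 n) 'X^(lrmax s).

Definition lrmax_series : fps {poly int} := Fps lrmax_poly.

(* Main.v *)
(* Let the permutation, with entries 0, ..., n-1, start with m.  The entries
   below m appear in increasing order (321).  If m > 0, the second entry is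
   below m, hence 0, since an ascent at the first position together with the
   entry m-1 would be a Fishburn pattern.  So for m = 0 a direct summand 1, and
   for m = 1 a direct summand 21, splits off.  If m > 1, then after the entry 1
   nothing exceeds m (3124), and everything before it, from the third position
   on, exceeds m and increases (321); hence the permutation is
   m, 0, m+1, ..., n-1, 1, ..., m-1, with n - m left-to-right maxima.
   Therefore T_(n+2) = t T_(n+1) + t T_n + (t + ... + t^n). *)
Require Import Defs.
From mathcomp Require Import all_boot all_algebra.
From mathcomp Require Import all_fingroup zify ring.

Set Implicit Arguments.
Unset Strict Implicit.
Unset Printing Implicit Defensive.

Import GRing.Theory.
Local Open Scope ring_scope.

(** * Permutations as functions on the natural numbers *)

Section OneLineNotation.
Local Open Scope nat_scope.

(* Extended by the identity outside [0, n), so that shifting identities such as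
   [shift1_S] hold at every index. *)
Definition one_line n (s : 'S_n) (i : nat) : nat :=
  oapp (fun o : 'I_n => s o : nat) i (insub i).

Lemma one_lineE n (s : 'S_n) (i : 'I_n) : one_line s i = s i.
Proof. by rewrite /one_line valK. Qed.

Lemma one_line_lt n (s : 'S_n) i : i < n -> one_line s i < n.
Proof. by move=> lt_in; rewrite (one_lineE s (Ordinal lt_in)). Qed.

Lemma one_line_inj n (s : 'S_n) i j :
  i < n -> j < n -> one_line s i = one_line s j -> i = j.
Proof.
move=> lt_in lt_jn.
rewrite (one_lineE s (Ordinal lt_in)) (one_lineE s (Ordinal lt_jn)).
by move=> /val_inj/perm_inj/(congr1 val).
Qed.

Lemma one_line_surj n (s : 'S_n) v :
  v < n -> exists2 i, i < n & one_line s i = v.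
Proof.
move=> lt_vn; exists ((s^-1)%g (Ordinal lt_vn)) => //.
by rewrite one_lineE permKV.
Qed.

Lemma eq_one_line n (s1 s2 : 'S_n) :
  (forall i, i < n -> one_line s1 i = one_line s2 i) -> s1 = s2.
Proof.
by move=> eq_s; apply/permP => i; apply: val_inj; rewrite /= -!one_lineE eq_s.
Qed.

(** On functions between natural numbers the pattern conditions are linear arithmetic, so that
    inserting entries or comparing explicit words is left to [lia]. *)
Definition fishburn_fun n (f : nat -> nat) :=
  forall j k, j.+1 < k -> k < n -> f j = (f k).+1 -> f j.+1 <= f j.
(** A classical pattern is recorded by the chain of its letters in order of value; the remaining
    comparisons follow by transitivity. *)
Definition av321 n (f : nat -> nat) :=
  forall i j k, i < j -> j < k -> k < n -> f k < f j -> f j < f i -> False.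
Definition av3124 n (f : nat -> nat) :=
  forall i j k l, i < j -> j < k -> k < l -> l < n ->
    f j < f k -> f k < f i -> f i < f l -> False.

Lemma fishburnP n (s : 'S_n) :
  reflect (fishburn_fun n (one_line s)) (fishburn s).
Proof.
apply: (iffP idP) => [fish_s j k lt_jk lt_kn fj|fish_s].
  have lt_jn : j < n by lia.
  have lt_j'n : j.+1 < n by lia.
  rewrite leqNgt; apply/negP => asc; case/negP: fish_s.
  apply/existsP; exists (Ordinal lt_jn); apply/existsP; exists (Ordinal lt_j'n).
  apply/existsP; exists (Ordinal lt_kn).
  by rewrite -!one_lineE eqxx lt_jk /= fj eqxx -fj.
apply/negP => /existsP[j /existsP[j' /existsP[k /and4P[/eqP ej' lt_jk /eqP ej]]]].
rewrite ltnNge; case/negP; rewrite -!one_lineE ej'.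
by apply: (fish_s j k) => //; rewrite !one_lineE.
Qed.

Lemma contains321P n (s : 'S_n) :
  reflect (av321 n (one_line s)) (~~ contains [:: 3; 2; 1] s).
Proof.
apply: (iffP idP) => [av_s i j k lt_ij lt_jk lt_kn|av_s].
  have lt_jn : j < n by lia.
  have lt_in : i < n by lia.
  move=> fkj fji; case/negP: av_s; apply/existsP.
  exists [ffun a => tnth [tuple Ordinal lt_in; Ordinal lt_jn; Ordinal lt_kn] a].
  apply/forallP => a; apply/forallP => b; rewrite -!one_lineE !ffunE.
  by case: a b => [[|[|[|a]]] ha] [[|[|[|b]]] hb] //;
    rewrite !(tnth_nth (Ordinal lt_in)) /=; lia.
apply/negP => /existsP[f /forallP f_s].
have f_lt a b := implyP (proj1 (andP (forallP (f_s a) b))).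
have f_eq a b := eqP (proj2 (andP (forallP (f_s a) b))).
pose o0 : 'I_(size [:: 3; 2; 1]) := @Ordinal 3 0 isT.
pose o1 : 'I_(size [:: 3; 2; 1]) := @Ordinal 3 1 isT.
pose o2 : 'I_(size [:: 3; 2; 1]) := @Ordinal 3 2 isT.
apply: (av_s (f o0) (f o1) (f o2)) => //; rewrite ?f_lt // !one_lineE.
  by rewrite (f_eq o2 o1).
by rewrite (f_eq o1 o0).
Qed.

Lemma contains3124P n (s : 'S_n) :
  reflect (av3124 n (one_line s)) (~~ contains [:: 3; 1; 2; 4] s).
Proof.
apply: (iffP idP) => [av_s i j k l lt_ij lt_jk lt_kl lt_ln|av_s].
  have lt_kn : k < n by lia.
  have lt_jn : j < n by lia.
  have lt_in : i < n by lia.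
  move=> fjk fki fil; case/negP: av_s; apply/existsP.
  exists [ffun a => tnth [tuple Ordinal lt_in; Ordinal lt_jn;
                                Ordinal lt_kn; Ordinal lt_ln] a].
  apply/forallP => a; apply/forallP => b; rewrite -!one_lineE !ffunE.
  by case: a b => [[|[|[|[|a]]]] ha] [[|[|[|[|b]]]] hb] //;
    rewrite !(tnth_nth (Ordinal lt_in)) /=; lia.
apply/negP => /existsP[f /forallP f_s].
have f_lt a b := implyP (proj1 (andP (forallP (f_s a) b))).
have f_eq a b := eqP (proj2 (andP (forallP (f_s a) b))).
pose o0 : 'I_(size [:: 3; 1; 2; 4]) := @Ordinal 4 0 isT.
pose o1 : 'I_(size [:: 3; 1; 2; 4]) := @Ordinal 4 1 isT.
pose o2 : 'I_(size [:: 3; 1; 2; 4]) := @Ordinal 4 2 isT.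
pose o3 : 'I_(size [:: 3; 1; 2; 4]) := @Ordinal 4 3 isT.
apply: (av_s (f o0) (f o1) (f o2) (f o3)) => //; rewrite ?f_lt // !one_lineE.
- by rewrite (f_eq o1 o2).
- by rewrite (f_eq o2 o0).
- by rewrite (f_eq o0 o3).
Qed.

Definition good n f := [/\ fishburn_fun n f, av321 n f & av3124 n f].

Lemma fishburn_321_3124P n (s : 'S_n) :
  reflect (good n (one_line s)) (s \in fishburn_321_3124 n).
Proof.
by rewrite inE; apply: (iffP and3P);
  move=> [/fishburnP ? /contains321P ? /contains3124P ?].
Qed.

(** Only positions before [i] are inspected, so no length enters and words of different lengths can
    be compared index by index. *)
Definition is_lrmax (f : nat -> nat) i := [forall j : 'I_i, f j < f i].

Lemma is_lrmaxP (f : nat -> nat) i :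
  reflect (forall j, j < i -> f j < f i) (is_lrmax f i).
Proof.
apply: (iffP forallP) => [lt_f j lt_ji|lt_f j]; last exact: lt_f.
exact: lt_f (Ordinal lt_ji).
Qed.

Lemma lrmax_one_line n (s : 'S_n) : lrmax s = \sum_(i < n) is_lrmax (one_line s) i.
Proof.
rewrite /lrmax -sum1dep_card big_mkcond; apply: eq_bigr => i _.
suff -> : [forall j : 'I_n, (j < i) ==> (s j < s i)] = is_lrmax (one_line s) i.
  by case: is_lrmax.
apply/forallP/is_lrmaxP => [lt_s j lt_ji|lt_s j].
  have lt_jn := ltn_trans lt_ji (ltn_ord i).
  by have:= implyP (lt_s (Ordinal lt_jn)) lt_ji; rewrite -!one_lineE.
by apply/implyP => /lt_s; rewrite !one_lineE.
Qed.

(** * Splitting off a direct summand 1 or 21 *)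

Section Shift1.
Variables f g : nat -> nat.
Hypotheses (g0 : g 0 = 0) (gS : forall i, g i.+1 = (f i).+1).

(** A leading 0 starts no forbidden pattern, because the first letter of each exceeds some later
    letter. *)
Lemma good_shift1 n : good n.+1 g <-> good n f.
Proof.
split=> -[fish av1 av2]; split.
- move=> j k lt_jk lt_kn fj; have:= fish j.+1 k.+1; rewrite !gS; lia.
- move=> i j k *; apply: (av1 i.+1 j.+1 k.+1); rewrite ?gS; lia.
- move=> i j k l *; apply: (av2 i.+1 j.+1 k.+1 l.+1); rewrite ?gS; lia.
- case=> [|j] [|k] //; rewrite !gS ?g0 //; have:= fish j k; lia.
- case=> [|i] [|j] [|k] //; rewrite !gS ?g0 //; have:= av1 i j k; lia.
- case=> [|i] [|j] [|k] [|l] //; rewrite !gS ?g0 //; have:= av2 i j k l; lia.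
Qed.

Lemma lrmax_shift1 n :
  \sum_(i < n.+1) is_lrmax g i = (\sum_(i < n) is_lrmax f i).+1.
Proof.
rewrite big_ord_recl /=.
have -> : is_lrmax g 0 by apply/is_lrmaxP.
rewrite add1n; congr _.+1; apply: eq_bigr => i _; rewrite /bump add1n.
congr nat_of_bool; apply/is_lrmaxP/is_lrmaxP => lt_f j lt_ji.
  by have:= lt_f j.+1; rewrite !gS; apply.
by case: j lt_ji => [|j] lt_ji; rewrite gS ?g0 // gS ltnS lt_f.
Qed.
End Shift1.

Section Shift2.
Variables f g : nat -> nat.
Hypotheses (g0 : g 0 = 1) (g1 : g 1 = 0) (gS : forall i, g i.+2 = (f i).+2).

(** A pattern starting at position 0 would need a later letter below 1, which can only be the 0 at
    position 1. Then 321 and 3124 lack a further letter below 1, and the Fishburn pattern needs the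
    0 beyond position 1. Starting at the 0 itself is impossible. *)
Lemma good_shift2 n : good n.+2 g <-> good n f.
Proof.
split=> -[fish av1 av2]; split.
- move=> j k lt_jk lt_kn fj; have:= fish j.+2 k.+2; rewrite !gS; lia.
- move=> i j k *; apply: (av1 i.+2 j.+2 k.+2); rewrite ?gS; lia.
- move=> i j k l *; apply: (av2 i.+2 j.+2 k.+2 l.+2); rewrite ?gS; lia.
- case=> [|[|j]] [|[|k]] //; rewrite ?gS ?g0 ?g1 //; have:= fish j k; lia.
- case=> [|[|i]] [|[|j]] [|[|k]] //; rewrite ?gS ?g0 ?g1 //.
  have:= av1 i j k; lia.
- case=> [|[|i]] [|[|j]] [|[|k]] [|[|l]] //; rewrite ?gS ?g0 ?g1 //.
  have:= av2 i j k l; lia.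
Qed.

Lemma lrmax_shift2 n :
  \sum_(i < n.+2) is_lrmax g i = (\sum_(i < n) is_lrmax f i).+1.
Proof.
rewrite !big_ord_recl /=.
have -> : is_lrmax g 0 by apply/is_lrmaxP.
have -> : is_lrmax g (bump 0 0) = false.
  by apply/negP => /is_lrmaxP/(_ 0 isT); rewrite g0 g1.
rewrite add0n add1n; congr _.+1; apply: eq_bigr => i _; rewrite /bump !add1n.
congr nat_of_bool; apply/is_lrmaxP/is_lrmaxP => lt_f j lt_ji.
  by have:= lt_f j.+2; rewrite !gS; apply.
by case: j lt_ji => [|[|j]] lt_ji; rewrite gS ?g0 ?g1 // gS !ltnS lt_f.
Qed.
End Shift2.

(** * The unique word with first entry [m] greater than 1 *)

(* In one-line notation: m, 0, m+1, ..., n-1, 1, ..., m-1. *)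
Definition tail_word n m i :=
  if i == 0 then m else if i == 1 then 0
  else if i < n - m + 1 then m + i - 1 else i - (n - m).

Lemma good_tail_word n m : 1 < m < n -> good n (tail_word n m).
Proof.
move=> /andP[lt1m lt_mn]; rewrite /tail_word; split.
- by move=> j k ? ?; do ![case: ifP]; lia.
- by move=> i j k ? ? ?; do ![case: ifP]; lia.
- by move=> i j k l ? ? ? ?; do ![case: ifP]; lia.
Qed.

(** The word is forced from left to right. At each position the expected value sits at some [p];
    earlier positions are already taken, and a later [p] creates a forbidden pattern. *)
Lemma good_tail_word_uniq n m (f : nat -> nat) :
  (forall i, i < n -> f i < n) ->
  (forall i j, i < n -> j < n -> f i = f j -> i = j) ->
  (forall v, v < n -> exists2 i, i < n & f i = v) ->
  1 < m < n -> f 0 = m -> good n f ->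
  forall i, i < n -> f i = tail_word n m i.
Proof.
move=> f_lt f_inj f_surj /andP[lt1m lt_mn] f0 [fish av1 av2].
have f10 : f 1 < f 0.
  have [k lt_kn fk] := f_surj m.-1 ltac:(lia).
  have neq0 := f_inj 0 1; have := fish 0 k.
  by case: k lt_kn fk => [|[|k]] *; lia.
have f1 : f 1 = 0.
  have [k lt_kn fk] := f_surj 0 ltac:(lia); have := av1 0 1 k.
  by case: k lt_kn fk => [|[|k]] *; lia.
have [q lt_qn fq] := f_surj 1 ltac:(lia).
have fup i : m + i.+1 < n -> f i.+2 = m + i.+1.
  elim/ltn_ind: i => i IHi lt_in.
  have [p lt_pn fp] := f_surj _ lt_in.
  have le_ip : i.+2 <= p.
    case: p lt_pn fp => [|[|p]] lt_pn fp; try lia.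
    by case: (ltnP p i) => // lt_pi; have := IHi p lt_pi; lia.
  have [->//|neq_ip] := eqVneq i.+2 p.
  have lt_ip : i.+2 < p by lia.
  have neqf := f_inj i.+2 p ltac:(lia) lt_pn.
  have neqf0 := f_inj i.+2 0 ltac:(lia) ltac:(lia).
  have neqf1 := f_inj i.+2 1 ltac:(lia) ltac:(lia).
  (* Otherwise positions 0, 1, i+2 and p carry the pattern 3124. *)
  have gt_um : m < f i.+2.
    by have := av2 0 1 i.+2 p; lia.
  (* By induction the entries m+1, ..., m+i occupy positions 2, ..., i+1. *)
  have gt_uv : m + i.+1 < f i.+2.
    rewrite ltnNge; apply/negP => le_uv.
    have := IHi (f i.+2 - m.+1) ltac:(lia) ltac:(lia) => eq_u.
    have := f_inj i.+2 (f i.+2 - m.+1).+2; lia.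
  have neqpq : p <> q by move=> eq_pq; move: fp; rewrite eq_pq fq; lia.
  (* The entry 1 at [q] gives the contradiction: before [p] it completes 3124 at 0, 1, q, p; after
     [p] it completes 321 at i+2, p, q. *)
  have := av2 0 1 q p; have := av1 i.+2 p q.
  have : q <> 0 by move=> eq_q; move: fq; rewrite eq_q; lia.
  have : q <> 1 by move=> eq_q; move: fq; rewrite eq_q; lia.
  lia.
have fdown i : i.+1 < m -> f (n - m + i.+1) = i.+1.
  elim/ltn_ind: i => i IHi lt_im.
  have [p lt_pn fp] := f_surj i.+1 ltac:(lia).
  set a := n - m + i.+1.
  (* The entries from [m] on are used up: [m] at position 0, the larger ones through [fup]. *)
  have ub : f a < m.
    rewrite ltnNge; apply/negP => le_ma.
    have lt_an := f_lt a ltac:(lia).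
    have [eq_a|neq_a] := eqVneq (f a) m; first by have := f_inj a 0; lia.
    have := fup (f a - m.+1) ltac:(lia); have := f_inj a (f a - m.+1).+2; lia.
  have lb : i < f a.
    rewrite ltnNge; apply/negP => le_ai.
    have [eq_a|neq_a] := eqVneq (f a) 0; first by have := f_inj a 1; lia.
    have := IHi (f a).-1 ltac:(lia) ltac:(lia).
    have := f_inj a (n - m + (f a).-1.+1); lia.
  have le_ap : a <= p.
    rewrite leqNgt; apply/negP => lt_pa.
    case: p lt_pn fp lt_pa => [|[|p]] lt_pn fp lt_pa; try lia.
    case: (ltnP (m + p.+1) n) => [lt_p|le_p]; first by have := fup p lt_p; lia.
    have := IHi (p.+1 - (n - m)) ltac:(lia) ltac:(lia).
    by rewrite (_ : _ + _ = p.+2); lia.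
  have [eq_ap|neq_ap] := eqVneq a p; first by rewrite eq_ap.
  (* If a < p and f a > i+1, then [m], [f a], i+1 is a 321. *)
  by have := av1 0 a p; lia.
move=> i lt_in; rewrite /tail_word.
case: i lt_in => [|[|i]] //= lt_in; case: ifP => lt_i.
  by rewrite fup; lia.
have := fdown (i.+1 - (n - m)) ltac:(lia).
by rewrite (_ : _ + _ = i.+2); lia.
Qed.

(** The left-to-right maxima are [m] at position 0 and the run m+1, ..., n-1 at positions 2, ...,
    n-m. *)
Lemma lrmax_tail_word n m : 1 < m < n ->
  \sum_(i < n) is_lrmax (tail_word n m) i = n - m.
Proof.
move=> /andP[lt1m lt_mn].
have lrE i : i < n -> is_lrmax (tail_word n m) i = (i == 0) || (1 < i < n - m + 1).
  case: i => [|[|i]] lt_in /=; first by apply/is_lrmaxP.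
    by apply/negP => /is_lrmaxP/(_ 0 isT).
  apply/is_lrmaxP/idP => [/(_ 0 isT)|lt_i j lt_ji]; rewrite /tail_word /=.
    by case: ifP; lia.
  by rewrite lt_i; do ![case: ifP]; lia.
under eq_bigr => i _ do rewrite lrE //.
rewrite -(big_mkord xpredT (fun i => ((i == 0) || (1 < i < n - m + 1) : nat))).
rewrite (@big_cat_nat _ _ _ (n - m + 1)) /=; try lia.
rewrite [X in _ + X]big_nat [X in _ + X]big1 ?addn0 => [|i]; last first.
  by case/andP=> le_i lt_i; rewrite (_ : _ || _ = false); lia.
rewrite (@big_cat_nat _ _ _ 2) /=; try lia.
rewrite big_nat_recl // big_nat1 /= [X in _ + X]big_nat.
rewrite (eq_bigr (fun=> 1)) => [|i]; last lia.
by rewrite -big_nat sum_nat_const_nat; lia.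
Qed.

(** * Inserting and deleting an entry of a permutation *)

Lemma lift_perm_ex n (s : 'S_n.+1) (i : 'I_n.+1) :
  exists s' : 'S_n, s = lift_perm i (s i) s'.
Proof.
(* The default [k] is never reached: by injectivity [s (lift i k)] differs from [s i]. *)
pose u k := odflt k (unlift (s i) (s (lift i k))).
have uK k : lift (s i) (u k) = s (lift i k).
  rewrite /u; case: unliftP => [j ->//|/perm_inj eq_i].
  by case/eqP: (neq_lift i k).
have u_inj : injective u.
  by move=> k1 k2 /(congr1 (lift (s i))); rewrite !uK => /perm_inj/lift_inj.
exists (perm u_inj); apply/permP => k; case: (unliftP i k) => [j|] ->.
  by rewrite lift_perm_lift permE uK.
by rewrite lift_perm_id.
Qed.

Lemma lift_perm_inj n (i j : 'I_n.+1) : injective (lift_perm i j).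
Proof.
move=> s1 s2 /permP eq_s; apply/permP => k.
by have := eq_s (lift i k); rewrite !lift_perm_lift => /lift_inj.
Qed.

(** These are the direct sums of 1 and of 21 with [s]. For the latter, the value 1 is put in front
    of [shift1 s], which keeps the 0 and raises all other entries. *)
Definition shift1 n (s : 'S_n) : 'S_n.+1 := lift_perm ord0 ord0 s.
Definition shift2 n (s : 'S_n) : 'S_n.+2 :=
  lift_perm ord0 (lift ord0 ord0) (shift1 s).

Lemma one_line_out n (s : 'S_n) i : n <= i -> one_line s i = i.
Proof. by move=> le_ni; rewrite /one_line insubF //= ltnNge le_ni. Qed.

Lemma shift1_0 n (s : 'S_n) : one_line (shift1 s) 0 = 0.
Proof. by rewrite (one_lineE _ ord0) lift_perm_id. Qed.

Lemma shift1_S n (s : 'S_n) i : one_line (shift1 s) i.+1 = (one_line s i).+1.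
Proof.
case: (ltnP i n) => [lt_in|le_ni]; last by rewrite !one_line_out.
rewrite (one_lineE s (Ordinal lt_in)).
rewrite -[i.+1]/(lift ord0 (Ordinal lt_in) : nat) one_lineE.
by rewrite lift_perm_lift.
Qed.

Lemma shift2_0 n (s : 'S_n) : one_line (shift2 s) 0 = 1.
Proof. by rewrite (one_lineE _ ord0) lift_perm_id. Qed.

Lemma shift2_1 n (s : 'S_n) : one_line (shift2 s) 1 = 0.
Proof.
rewrite -[1]/(lift (ord0 : 'I_n.+2) ord0 : nat) one_lineE lift_perm_lift.
by rewrite lift_perm_id.
Qed.

Lemma shift2_S n (s : 'S_n) i : one_line (shift2 s) i.+2 = (one_line s i).+2.
Proof.
case: (ltnP i n) => [lt_in|le_ni]; last by rewrite !one_line_out.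
rewrite (one_lineE s (Ordinal lt_in)).
rewrite -[i.+2]/(lift ord0 (lift ord0 (Ordinal lt_in)) : nat) one_lineE.
by rewrite !lift_perm_lift.
Qed.

(** * Classification by the first entry *)

Lemma fishburn_first0 n :
  [set s in fishburn_321_3124 n.+1 | s ord0 == ord0]
    = @shift1 n @: fishburn_321_3124 n.
Proof.
have shiftF (s : 'S_n) :
    (shift1 s \in fishburn_321_3124 n.+1) = (s \in fishburn_321_3124 n).
  have [? ?] := good_shift1 (shift1_0 s) (shift1_S s) n.
  by apply/fishburn_321_3124P/fishburn_321_3124P.
apply/setP => s; rewrite inE; apply/andP/imsetP => [[Fs /eqP s0]|[s' Fs' ->]].
  have [s' eq_s] := lift_perm_ex s ord0; rewrite s0 in eq_s.
  by exists s' => //; rewrite -shiftF /shift1 -eq_s.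
by rewrite shiftF Fs' /shift1 lift_perm_id.
Qed.

Lemma fishburn_first1 n :
  [set s in fishburn_321_3124 n.+2 | s ord0 == lift ord0 ord0]
    = @shift2 n @: fishburn_321_3124 n.
Proof.
have shiftF (s : 'S_n) :
    (shift2 s \in fishburn_321_3124 n.+2) = (s \in fishburn_321_3124 n).
  have [? ?] := good_shift2 (shift2_0 s) (shift2_1 s) (shift2_S s) n.
  by apply/fishburn_321_3124P/fishburn_321_3124P.
apply/setP => s; rewrite inE; apply/andP/imsetP => [[Fs /eqP s0]|[s' Fs' ->]].
  (* If the entry 0 came later than position 1, the first entry 1 would be followed by an ascent,
     and with this 0 form a Fishburn pattern. *)
  have s1 : s (lift ord0 ord0) = ord0.
    have /fishburn_321_3124P[fish _ _] := Fs.
    have f0 : one_line s 0 = 1 by rewrite (one_lineE s ord0) s0.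
    have [k lt_kn fk] := @one_line_surj _ s 0 isT.
    apply: val_inj; rewrite /= -[LHS]one_lineE.
    have := fish 0 k; have := @one_line_inj _ s 0 1 isT isT.
    rewrite -[_ (lift _ _)]/1; case: k lt_kn fk => [|[|k]] lt_kn fk; lia.
  have [s1' eq_s] := lift_perm_ex s ord0; rewrite s0 in eq_s.
  have s1'0 : s1' ord0 = ord0.
    move: s1; rewrite eq_s lift_perm_lift => eq_l.
    apply: (@lift_inj _ (lift ord0 ord0)); rewrite eq_l.
    by apply: val_inj.
  have [s' eq_s1'] := lift_perm_ex s1' ord0; rewrite s1'0 in eq_s1'.
  have eq_s' : s = shift2 s' by rewrite /shift2 /shift1 -eq_s1' -eq_s.
  by exists s' => //; rewrite -shiftF -eq_s'.
by rewrite shiftF Fs' /shift2 lift_perm_id.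
Qed.

(** This makes the word a permutation. The default [i] of [insubd] is never taken, since all entries
    are below [n]. *)
Lemma tail_word_inj n m : 1 < m < n ->
  injective (fun i : 'I_n => insubd i (tail_word n m i)).
Proof.
move=> /andP[lt1m lt_mn] i j /(congr1 val); rewrite !val_insubd.
have t_lt (k : 'I_n) : tail_word n m k < n.
  by have := ltn_ord k; rewrite /tail_word; do ![case: ifP]; lia.
rewrite !t_lt => eq_t; apply: val_inj; move: eq_t (ltn_ord i) (ltn_ord j).
by rewrite /tail_word /=; do ![case: ifP]; lia.
Qed.

(** Fibre and statistic are given together, so that each such first entry contributes a single
    monomial. *)
Lemma fishburn_first_ge2 n (m : 'I_n.+1) : 1 < m ->
  exists2 s : 'S_n.+1,
    [set s in fishburn_321_3124 n.+1 | s ord0 == m] = [set s]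
    & lrmax s = n.+1 - m.
Proof.
move=> lt1m; have lt_m : 1 < m < n.+1 by rewrite lt1m ltn_ord.
pose s := perm (tail_word_inj lt_m).
have sE i : i < n.+1 -> one_line s i = tail_word n.+1 m i.
  move=> lt_in; rewrite (one_lineE s (Ordinal lt_in)) permE val_insubd /=.
  by rewrite ifT // /tail_word; do ![case: ifP]; lia.
exists s; last first.
  rewrite lrmax_one_line -(lrmax_tail_word lt_m); apply: eq_bigr => i _.
  congr nat_of_bool; apply/is_lrmaxP/is_lrmaxP => lt_t j lt_ji;
    by have := lt_t j lt_ji; rewrite !sE // (ltn_trans lt_ji).
apply/setP => s'; rewrite inE [RHS]inE.
apply/andP/eqP => [[/fishburn_321_3124P Fs' /eqP s'0]|->].
  apply: eq_one_line => i lt_in; rewrite sE //.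
  apply: good_tail_word_uniq lt_in => //.
  - exact: one_line_lt.
  - exact: one_line_inj.
  - exact: one_line_surj.
  - by rewrite (one_lineE s' ord0) s'0.
split; last by apply/eqP/val_inj; rewrite /= -[LHS]one_lineE sE.
apply/fishburn_321_3124P.
have [fish av1 av2] := good_tail_word lt_m; split.
- by move=> j k lt_jk lt_kn; rewrite !sE; try lia; apply: fish.
- by move=> i j k lt_ij lt_jk lt_kn; rewrite !sE; try lia; apply: av1.
- move=> i j k l lt_ij lt_jk lt_kl lt_ln.
  by rewrite !sE; try lia; apply: av2.
Qed.

Lemma lrmax_shift1E n (s : 'S_n) : lrmax (shift1 s) = (lrmax s).+1.
Proof. by rewrite !lrmax_one_line (lrmax_shift1 (shift1_0 s) (shift1_S s)). Qed.

Lemma lrmax_shift2E n (s : 'S_n) : lrmax (shift2 s) = (lrmax s).+1.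
Proof.
by rewrite !lrmax_one_line (lrmax_shift2 (shift2_0 s) (shift2_1 s) (shift2_S s)).
Qed.
End OneLineNotation.

(** * The recurrence for the polynomials *)

Lemma lrmax_poly_by_first n :
  lrmax_poly n.+1 =
    \sum_(m < n.+1)
       \sum_(s in [set s in fishburn_321_3124 n.+1 | s ord0 == m]) 'X^(lrmax s).
Proof.
rewrite /lrmax_poly (partition_big (fun s : 'S_n.+1 => s ord0) xpredT) //=.
by apply: eq_bigr => m _; apply: eq_bigl => s; rewrite [RHS]inE.
Qed.

Lemma sum_first0 n :
  \sum_(s in [set s in fishburn_321_3124 n.+1 | s ord0 == ord0]) 'X^(lrmax s)
    = 'X * lrmax_poly n.
Proof.
rewrite fishburn_first0 big_imset /= => [|s1 s2 _ _]; last exact: lift_perm_inj.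
by rewrite mulr_sumr; apply: eq_bigr => s _; rewrite lrmax_shift1E exprS.
Qed.

Lemma sum_first1 n :
  \sum_(s in [set s in fishburn_321_3124 n.+2 | s ord0 == lift ord0 ord0])
     'X^(lrmax s) = 'X * lrmax_poly n.
Proof.
rewrite fishburn_first1 big_imset /= => [|s1 s2 _ _].
  by rewrite mulr_sumr; apply: eq_bigr => s _; rewrite lrmax_shift2E exprS.
by move=> /lift_perm_inj/lift_perm_inj.
Qed.

Lemma lrmax_poly0 : lrmax_poly 0 = 1.
Proof.
rewrite /lrmax_poly (eq_bigl (pred1 (1%g : 'S_0))) => [|s /=].
  by rewrite big_pred1_eq lrmax_one_line big_ord0.
have -> : s = 1%g by apply/permP => -[].
by rewrite eqxx; apply/fishburn_321_3124P.
Qed.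

Lemma lrmax_poly1 : lrmax_poly 1 = 'X.
Proof. by rewrite lrmax_poly_by_first big_ord1 sum_first0 lrmax_poly0 mulr1. Qed.

Lemma lrmax_poly_rec n :
  lrmax_poly n.+2 =
    'X * lrmax_poly n.+1 + 'X * lrmax_poly n + \sum_(i < n) 'X^(i.+1).
Proof.
rewrite lrmax_poly_by_first !big_ord_recl sum_first0 sum_first1 addrA.
(* Reversal makes index [i] stand for the first entry n+1-i, which in length n+2 leaves i+1
   maxima. *)
congr (_ + _); rewrite (reindex_inj rev_ord_inj); apply: eq_bigr => i _.
have lt1 : (1 < lift (ord0 : 'I_n.+2) (lift ord0 (rev_ord i)))%N by [].
have [s -> lr_s] := fishburn_first_ge2 lt1.
by rewrite big_set1 lr_s /= /bump; congr ('X^_); have := ltn_ord i; lia.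
Qed.

(** * From the recurrence to the generating function *)

Section Fps.
Variable R : comNzRingType.
Implicit Types a b : fps R.

Lemma coefs_add a b n : coefs (a + b) n = coefs a n + coefs b n.
Proof. by []. Qed.

Lemma coefs_const_mul r a n : coefs (fps_const r * a) n = r * coefs a n.
Proof.
rewrite coefs_mul big_ord_recl /= subn0 big1 ?addr0 // => i _.
by rewrite mul0r.
Qed.

Lemma coefs_var_mul a n :
  coefs (fps_var R * a) n = if n is n'.+1 then coefs a n' else 0.
Proof.
rewrite coefs_mul; case: n => [|n]; first by rewrite big_ord1 mul0r.
rewrite !big_ord_recl /= mul0r add0r mul1r subn1 big1 ?addr0 // => i _.
by rewrite mul0r.
Qed.
End Fps.

Theorem proposition8p13 :
  let t : fps {poly int} := fps_const 'X in
  let x : fps {poly int} := fps_var {poly int} in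
  lrmax_series =
    (1 - (t + 1) * x + t * x ^+ 2 + t * x ^+ 3)
      / ((1 - t * x - t * x ^+ 2) * (1 - t * x) * (1 - x)).
Proof.
move=> t x.
(* [S] collects the sums t + ... + t^n at x^(n+2), and [H] is t x^3/(1-x). Each is described by a
   linear equation, with powers of [x] as nested products so that coefficients are read off as
   shifts. *)
pose S : fps {poly int} :=
  Fps (fun n => if n is n'.+2 then \sum_(i < n') 'X^(i.+1) else 0).
pose H : fps {poly int} := Fps (fun n => if n is _.+3 then 'X else 0).
have E1 : lrmax_series =
    1 + t * (x * lrmax_series) + t * (x * (x * lrmax_series)) + S.
  apply: fpsP => -[|[|n]]; rewrite !coefs_add ?coefs_const_mul !coefs_var_mul /=.
  - by rewrite lrmax_poly0 !mulr0 !addr0.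
  - by rewrite lrmax_poly1 lrmax_poly0 mulr0 mulr1 add0r !addr0.
  - by rewrite lrmax_poly_rec add0r.
have E2 : S = t * (x * S) + H.
  apply: fpsP => -[|[|[|n]]]; rewrite !coefs_add ?coefs_const_mul !coefs_var_mul /=;
    rewrite ?big_ord0 ?mulr0 ?addr0 //.
  rewrite big_ord_recl addrC mulr_sumr; congr (_ + _).
have E3 : H = x * H + t * (x * (x * (x * 1))).
  apply: fpsP => -[|[|[|[|n]]]]; rewrite !coefs_add ?coefs_const_mul !coefs_var_mul /=;
    by rewrite ?mulr0 ?mulr1 ?addr0 ?add0r.
set D := (X in _ / X).
(* The constant term of [D] is 1. *)
have uD : D \is a GRing.unit.
  rewrite -[_ \is a _]/(fps_unit D) /fps_unit /D !coefs_mul0 /=.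
  rewrite ?big_ord1 ?big_ord_recl /=.
  by rewrite ?(mulr0, mul0r, oppr0, subr0, addr0, mulr1) unitr1.
apply: (canRL (mulrK uD)); rewrite /D.
(* Each factor of the denominator removes one layer: the first leaves 1 + S, the second turns [S]
   into [H], the third turns [H] into t x^3. What remains is (1-tx)(1-x) + t x^3, the numerator. *)
have S1 : lrmax_series * (1 - t * x - t * x ^+ 2) = 1 + S.
  by rewrite [LHS]mulrBr mulrBr {1}E1; ring.
have S2 : S * (1 - t * x) = H by rewrite [LHS]mulrBr {1}E2; ring.
have S3 : H * (1 - x) = t * x ^+ 3 by rewrite [LHS]mulrBr {1}E3; ring.
rewrite [LHS]mulrA [X in X * _]mulrA.
by rewrite S1 mulrDl mul1r S2 mulrDl S3; ring.
Qed.
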